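(* Let $c$ be a positive integer, let $d$ be a non-negative integer, and let $G$ be a finite (abstract) group. Assume that $G$ is $d$-generated (i.e., $G$ can be generated by $d$ elements) and that all orbits of the natural action of $\operatorname{Aut}(G)$ on $G$ are of length at most $c$. Then $$|G|\leqslant c^{d\cdot c^d\cdot(1+\lfloor d\log_2 c\rfloor)}+1.$$
   Context: $\operatorname{Aut}(G)$ denotes the full automorphism group of $G$. *)

(* Defs.v *)
From mathcomp Require Import all_boot all_order all_algebra reals exp all_fingroup.

Set Implicit Arguments.
Unset Strict Implicit.
Unset Printing Implicit Defensive.

Import GroupScope.

(* The entries of the tuple may repeat, so at most d distinct generators. *)
Definition d_generated (gT : finGroupType) (d : nat) (G : {group gT}) : Prop :=
  exists t : d.-tuple gT, <<[set x in t]>> = G.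

Definition log2 (R : realType) (x : R) : R := (ln x / ln 2%:R)%R.

(* Main.v *)
Require Import Defs.
From mathcomp Require Import all_boot all_order all_algebra reals exp all_fingroup.
From mathcomp Require Import all_solvable zify.

Set Implicit Arguments.
Unset Strict Implicit.
Unset Printing Implicit Defensive.

(** Let Z be the center of G, m its index and o its exponent. An automorphism
    is determined by the images of the d generators, and each generator has at
    most c images, so |Aut G| <= c^d (leq_card_Aut). Since Aut G contains the
    m inner automorphisms, m <= c^d. The order of G is m |Z|, and Z is abelian,
    so it remains to bound its number of generators and its exponent.

    Rank. By Schreier's index formula a subgroup of index m in a d-generated
    group has 1 + m(d-1) generators (Schreier_generators); hence
    |Z| <= o^(1 + m(d-1)).

    Exponent. The transfer of G into Z is x |-> x^m, so x |-> x^m is a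
    homomorphism into Z. Therefore x |-> x^u is an automorphism of G as soon as
    u = 1 modulo m and u is coprime to |G| (expg_aut). Let z be an element of Z
    of order o, and write o = ab with b the largest divisor of o that is coprime
    to m. The powers z^u for such u take at least phi(b) a / gcd(a, m) values
    (leq_card_unit_powers), all in its orbit. This orbit has length q <= c, and
    even q m <= |Aut G|, because inner automorphisms fix z. With b <= 2 phi(b)^2
    this gives o = ab <= 2 phi(b) (a phi(b)) <= 2c |Aut G|
    (leq_exponent_center).

    For c >= 2 this reads o <= c^(d+2), and
    |G| <= m o^(1 + m(d-1)) <= c^(d c^d (1+d)) (leq_bound_exponent), while the
    floor of d log2 c is at least d. For c = 1 the automorphism group is trivial
    and the same exponent bound shows that G is elementary abelian of exponent
    at most 2; as it is then characteristically simple while every subgroup is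
    characteristic, it has order at most 2 (leq_card_Aut_trivial). This is where
    the summand 1 of the bound is needed. *)

(** * Arithmetic *)

Section Arithmetic.

(** Both sides are multiplicative, and an odd prime power p^k satisfies
    p^k <= p^(2k-2) (p-1)^2 because p <= (p-1)^2. *)
Lemma odd_leq_totient_sqr n : odd n -> n <= totient n ^ 2.
Proof.
elim/ltn_ind: n => n IHn odd_n; have [n_le1 | n_gt1] := leqP n 1.
  by case: n n_le1 odd_n {IHn} => [|[]].
have n_gt0 := ltnW n_gt1; set p := pdiv n.
have p_pr : prime p := pdiv_prime n_gt1.
have p_gt2 : 2 < p by rewrite odd_prime_gt2 // (dvdn_odd (pdiv_dvd n)).
have k_gt0 : 0 < logn p n by rewrite logn_gt0 mem_primes p_pr n_gt0 pdiv_dvd.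
have lt_np : n`_p^' < n.
  rewrite -{2}(partnC p n_gt0) ltn_Pmull ?part_gt0 // p_part.
  by rewrite -(expn0 p) ltn_exp2l // prime_gt1.
have odd_np : odd n`_p^' by apply: dvdn_odd odd_n; apply: dvdn_part.
rewrite -{1 2}(partnC p n_gt0) totient_coprime ?coprime_partC // expnMn.
apply: leq_mul (IHn _ lt_np odd_np).
rewrite p_part; case: (logn p n) k_gt0 => // k _.
rewrite totient_pfactor //= expnMn -expnM expnS leq_mul //.
  case: p p_gt2 {p_pr lt_np odd_np} => // q q_gt1.
  by rewrite /= expnS expn1; nia.
by rewrite leq_pexp2l ?prime_gt0 // leq_pmulr.
Qed.

(** The factor 2 is lost on the 2-part only, and only when this is 2 itself. *)
Lemma leq_totient_sqr n : n <= 2 * totient n ^ 2.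
Proof.
have [-> // | n_gt0] := posnP n.
rewrite -{1 2}(partnC 2 n_gt0) totient_coprime ?coprime_partC // expnMn mulnA.
apply: leq_mul; last by rewrite odd_leq_totient_sqr // odd_2'nat part_pnat.
rewrite p_part; case: (logn 2 n) => [|k] //.
rewrite totient_pfactor //= mul1n -expnM expnS leq_mul2l /=.
by rewrite leq_pexp2l // leq_pmulr.
Qed.

Lemma coprime_pi_nat (m a w : nat) :
  0 < m -> \pi(m).-nat a -> coprime m w -> coprime a w.
Proof.
move=> m_gt0 pi_a; have [-> | w_gt0] := posnP w.
  rewrite /coprime !gcdn0 => /eqP m1; rewrite m1 in pi_a.
  have a_gt0 : 0 < a by case/andP: pi_a.
  have: coprime a a.
    by apply: (pnat_coprime pi_a); rewrite -coprime_pi' ?coprime1n.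
  by rewrite /coprime gcdnn.
by rewrite coprime_pi' //; apply: pnat_coprime.
Qed.

(** Here k is the number of generators of the center, m its index and o its
    exponent. *)
Lemma leq_bound_exponent c d m o k :
  1 < c -> 0 < d -> m <= c ^ d -> o <= 2 * c * c ^ d -> k + m <= m * d + 1 ->
  m * o ^ k <= c ^ (d * c ^ d * (1 + d)).
Proof.
move=> c_gt1 d_gt0 le_m le_o le_k.
have c_gt0 := ltnW c_gt1.
have lt_d : d < c ^ d := ltn_expl d c_gt1.
have le_oc : o <= c ^ d.+2.
  apply: leq_trans le_o _; rewrite 2!expnS mulnA leq_mul2r leq_mul2r c_gt1.
  by rewrite !orbT.
apply: (@leq_trans (c ^ (d + d.+2 * k))).
  by rewrite expnD expnM leq_mul //; case: k {le_k} => // k; rewrite leq_exp2r.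
(* The terms d + d.+2 outside the multiple of c ^ d are absorbed by
   2 * c ^ d because d < c ^ d. *)
rewrite leq_pexp2l //; move: (c ^ d) lt_d le_m => A lt_d le_m.
have : k <= 1 + A * d.-1.
  by have : m * d.-1 <= A * d.-1; [rewrite leq_mul2r le_m orbT | nia].
case: d d_gt0 lt_d {le_k le_oc le_o} => // d _ lt_d /= le_k.
have : d.+3 * k <= d.+3 * (1 + A * d) by rewrite leq_mul2l le_k orbT.
nia.
Qed.

Import Order.POrderTheory GRing.Theory Num.Theory.

Lemma leq_truncn_log2 (R : realType) c d : 1 < c ->
  d <= Num.truncn (d%:R * log2 (c%:R : R))%R.
Proof.
move=> c_gt1; have ln2_gt0 : (0 < ln (2%:R : R))%R.
  by rewrite ln_gt0 // ltr1n.
have le1 : (1 <= log2 (c%:R : R))%R.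
  rewrite /log2 ler_pdivlMr // mul1r ler_ln ?posrE ?ltr0n ?ler_nat //.
  exact: ltnW.
have le_d : (d%:R <= d%:R * log2 (c%:R : R))%R.
  by rewrite ler_peMr ?ler0n.
rewrite truncn_ge_nat //.
by rewrite (le_trans _ le_d) ?ler0n.
Qed.

End Arithmetic.

(** * Power automorphisms *)

Section PowerAutomorphisms.
Import GroupScope FiniteModule.
Variables (gT : finGroupType) (G : {group gT}).
Local Notation Z := 'Z(G).
Local Notation m := #|G : Z|.

(** In the expansion of the transfer along the cycles of g on the cosets of Z,
    each factor x g^n x^-1 is central, so equals g^n, and the lengths n of the
    cycles add up to the index. *)
Lemma transfer_center (cZ : abelian (idm Z @* Z)) g :
  g \in G -> fmval (transfer G cZ g) = g ^+ m.
Proof.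
move=> Gg; have sZG := center_sub G; pose C := rcosets Z G :* <[g]>.
have trX : is_transversal (transversal C G) C G.
  exact/transversalP/rcosets_cycle_partition.
move: (transversal C G) trX => X trX.
have sXG := subsetP (transversal_sub trX).
rewrite (transfer_cycle_expansion sZG cZ Gg trX) fmval_sum.
rewrite -(sum_index_rcosets_cycle sZG Gg trX).
rewrite (big_morph _ (expgnDr g) (expg0 g)).
apply: eq_bigr => x Xx; have Gx := sXG x Xx.
have [z Zz def_gn] := rcosetP (mulg_exp_card_rcosets Z%G g x).
have {def_gn} -> : g ^+ #|<[g]> : Z :* x| = z.
  by apply: (mulgI x); rewrite def_gn (centerC Gx Zz).
have -> : z ^ x^-1 = z by rewrite conjgE invgK mulgA (centerC Gx Zz) mulgK.
by rewrite /restrm /= fmodK //; apply: mem_morphim.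
Qed.

Lemma expg_index_center g : g \in G -> g ^+ m \in Z.
Proof.
have cZ : abelian (idm Z @* Z) by rewrite im_idm center_abelian.
move=> Gg; rewrite -(transfer_center cZ Gg).
have /morphimP[z Zz _ def_z] := fmodP (transfer G cZ g).
by rewrite [fmval _]def_z.
Qed.

Lemma expgMn_index_center :
  {in G &, {morph (fun x => x ^+ m) : x y / x * y}}.
Proof.
have cZ : abelian (idm Z @* Z) by rewrite im_idm center_abelian.
move=> x y Gx Gy /=; rewrite -!(transfer_center cZ) ?groupM //.
by rewrite transferM ?center_sub.
Qed.

(** If u = 1 + k m then x^u is x times a central power on which x |-> x^(k m)
    is multiplicative; coprimality to |G| makes the kernel trivial. *)
Lemma expg_aut u : u = 1 %[mod m] -> coprime u #|G| ->
  exists2 a, a \in Aut G & {in G, forall x, a x = x ^+ u}.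
Proof.
move=> u1 co_uG; have Zm := expg_index_center.
have Mm := expgMn_index_center.
have [u0 | u_gt0] := posnP u.
  (* Being coprime to 0, the order of G is 1. *)
  rewrite u0 /coprime gcd0n in co_uG *.
  exists 1 => [|x Gx]; first exact: group1.
  have G1 : G :=: 1 by apply: card1_trivg; apply/eqP.
  by move: Gx; rewrite G1 => /set1P->; rewrite perm1 expg1n.
have [k def_u] : exists k, u = (1 + k * m)%N.
  have /eqP := u1; rewrite eqn_mod_dvd // => /dvdnP[k def_k].
  by exists k; lia.
have Mu : {in G &, {morph (fun x => x ^+ u) : x y / x * y}}.
  move=> x y Gx Gy /=; rewrite def_u !expgnDr !expg1 mulnC !expgM Mm //.
  have Gxm : x ^+ m \in G by apply: groupX.
  rewrite expgMn; last exact: (centerC Gxm (Zm y Gy)).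
  rewrite !mulgA; congr (_ * _); rewrite -!mulgA; congr (_ * _).
  by rewrite (centerC Gy) // groupX ?Zm.
pose f := Morphism Mu.
have injf : 'injm f.
  apply/subsetP=> x /morphpreP[Gx /set1P /= xu1]; rewrite inE -order_eq1.
  have := order_dvdG Gx; move/eqP: xu1; rewrite -order_dvdn => ox_u ox_G.
  by rewrite -dvdn1 -(eqP co_uG) dvdn_gcd ox_u.
have imf : f @* G = G.
  apply/(morphim_fixP injf _ (subxx G))/subsetP=> _ /morphimP[x _ Gx ->].
  exact: groupX.
by exists (aut injf imf) => [|x Gx]; rewrite ?Aut_aut ?autE.
Qed.

End PowerAutomorphisms.

Section UnitPowers.
Import GroupScope.
Variables (gT : finGroupType).

(** By the Chinese remainder theorem u can be chosen congruent to 1 + j m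
    modulo a m and to a given unit modulo b. Such a u is coprime to a because
    the primes of a divide m. The resulting powers of z are distinct for
    distinct units modulo b and distinct j < a / gcd(a, m). *)
Lemma leq_card_unit_powers (z : gT) (a b m : nat) (S : {set gT}) :
    (0 < m)%N -> #[z] = (a * b)%N -> \pi(m).-nat a -> coprime m b ->
    (forall u, u = 1 %[mod m] -> coprime u #[z] -> z ^+ u \in S) ->
  (a * totient b <= gcdn a m * #|S|)%N.
Proof.
move=> m_gt0 oz pi_a co_mb Su.
have [a_gt0 b_gt0] : (0 < a)%N /\ (0 < b)%N.
  by apply/andP; rewrite -muln_gt0 -oz order_gt0.
have co_ab : coprime a b := coprime_pi_nat m_gt0 pi_a co_mb.
have co_amb : coprime (a * m) b by rewrite coprimeMl co_ab.
pose k := (a %/ gcdn a m)%N; have def_a : (gcdn a m * k = a)%N.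
  by rewrite mulnC divnK ?dvdn_gcdl.
pose u (vj : 'I_b * 'I_k) := chinese (a * m) b (1 + vj.2 * m) vj.1.
pose D := setX [set v : 'I_b | coprime b v] [set: 'I_k].
have um vj : u vj = 1 + vj.2 * m %[mod a * m] := chinese_modl co_amb _ _.
have ub vj : u vj = vj.1 %[mod b] := chinese_modr co_amb _ _.
have cardD : #|D| = (totient b * k)%N.
  rewrite cardsX cardsT card_ord totient_count_coprime big_mkord.
  congr (_ * _)%N; rewrite -sum1_card big_mkcond /=.
  by apply: eq_bigr => v _; rewrite inE; case: coprime.
have inj_zu : {in D &, injective (fun vj => z ^+ u vj)}.
  move=> [v j] [w i] _ _ /= /eqP; rewrite eq_expg_mod_order oz.
  rewrite chinese_remainder // => /andP[eq_a eq_b].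
  have eq_vw : v = w.
    apply/val_inj; move: eq_b; rewrite !ub /= !modn_small //.
    by move/eqP.
  have {eq_a} : 1 + j * m == 1 + i * m %[mod a].
    rewrite -(modn_dvdm (1 + j * m) (dvdn_mulr m (dvdnn a))).
    rewrite -(modn_dvdm (1 + i * m) (dvdn_mulr m (dvdnn a))).
    by rewrite -(um (v, j)) -(um (w, i)) !modn_dvdm ?dvdn_mulr.
  suffices inj_j (i1 i2 : 'I_k) : 1 + i2 * m == 1 + i1 * m %[mod a] ->
      (i1 <= i2)%N -> i1 = i2.
    rewrite eq_vw => eq_ij; congr (_, _); case/orP: (leq_total i j) => ?.
      by rewrite -(inj_j i j).
    by rewrite (inj_j j i) // eq_sym.
  move=> eq_i12 le_i12; apply/val_inj/eqP; rewrite eqn_leq le_i12 /= -subn_eq0.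
  move: eq_i12; rewrite eqn_modDl eqn_mod_dvd ?leq_mul2r ?le_i12 ?orbT //.
  rewrite -mulnBl -def_a -{2}(divnK (dvdn_gcdr a m)) mulnA [X in _ %| X]mulnC.
  rewrite dvdn_pmul2l ?gcdn_gt0 ?a_gt0 // Gauss_dvdl; last first.
    rewrite /coprime -(@eqn_pmul2r (gcdn a m)) ?gcdn_gt0 ?a_gt0 // mul1n.
    by rewrite muln_gcdl [(k * _)%N]mulnC def_a divnK ?dvdn_gcdr.
  have [// | i_gt0] := posnP (i2 - i1).
  by rewrite gtnNdvd // (leq_ltn_trans (leq_subr _ _)).
have sub_S : [set z ^+ u vj | vj in D] \subset S.
  apply/subsetP=> _ /imsetP[[v j] /setXP[/[!inE] co_bv _] ->]; set vj := (v, j).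
  have um1 : u vj = 1 %[mod m].
    rewrite -(modn_dvdm _ (dvdn_mull a (dvdnn m))) um.
    by rewrite modn_dvdm ?dvdn_mull // addnC modnMDl.
  apply: Su => //; rewrite oz coprimeMr; apply/andP; split; last first.
    by rewrite -coprime_modl ub coprime_modl coprime_sym.
  have co_um : coprime (u vj) m.
    by rewrite -coprime_modl um1 coprime_modl coprime1n.
  by rewrite coprime_sym; apply: coprime_pi_nat pi_a _; rewrite // coprime_sym.
have := subset_leq_card sub_S; rewrite card_in_imset // cardD => le_S.
rewrite -{1}def_a -mulnA leq_mul2l; apply/orP; right.
by rewrite mulnC.
Qed.
End UnitPowers.

(** * Generators: automorphisms and subgroups *)

Section Generators.
Import GroupScope.
Variables (gT : finGroupType) (G : {group gT}) (d : nat) (s : 'I_d -> gT).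
Hypothesis genG : <<[set s i | i : 'I_d]>> = G.

(** In a finite group the inverse of a generator is a power of it, so every
    element is a product of generators. *)
Lemma gen_sub_mulr_closed (X : {set gT}) :
  1 \in X -> (forall x i, x \in X -> x * s i \in X) -> G \subset X.
Proof.
move=> X1 Xs; apply/subsetP=> g; rewrite -genG => /gen_prodgP[n [e se ->]].
elim: n e se => [|n IHn] e se; first by rewrite big_ord0.
rewrite big_ord_recr /=; have /imsetP[i _ ->] := se ord_max.
by apply: Xs; apply: IHn => j; apply: se.
Qed.

Lemma generator_mem i : s i \in G.
Proof. by rewrite -genG mem_gen // imset_f. Qed.

Lemma leq_card_Aut c :
  (forall x, x \in G -> #|orbit 'P (Aut G) x| <= c)%N -> (#|Aut G| <= c ^ d)%N.
Proof.
move=> le_c; pose ev (a : {perm gT}) := [ffun i => a (s i)].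
have inj_ev : {in Aut G &, injective ev}.
  move=> a b AutGa AutGb /ffunP eq_ab; apply: (eq_Aut AutGa AutGb) => x Gx.
  rewrite -genG in Gx; have /gen_prodgP[n [e se ->]] := Gx.
  have Ge i : e i \in G by rewrite -genG mem_gen.
  rewrite -(autmE AutGa) -(autmE AutGb) !morph_prod //; apply: eq_bigr => i _.
  by have /imsetP[j _ ->] := se i; have := eq_ab j; rewrite !ffunE.
rewrite -(card_in_imset inj_ev).
pose F i : pred gT := mem (orbit 'P (Aut G) (s i)).
apply: (@leq_trans #|family F|).
  apply/subset_leq_card/subsetP=> _ /imsetP[a AutGa ->].
  by apply/familyP=> i; rewrite ffunE; apply: mem_orbit.
rewrite card_family.
have -> : (c ^ d = c ^ size (enum 'I_d))%N by rewrite size_enum_ord.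
rewrite /image_mem; elim: (enum _) => //= i r IHr; rewrite expnS leq_mul //.
by apply: le_c; apply: generator_mem.
Qed.

Variable H : {group gT}.
Hypothesis sHG : H \subset G.

(** A spanning tree of the coset graph of H, grown one vertex at a time: T is
    the set of labels of the vertices reached so far, and P is the set of edges
    used, an edge being a label in T together with the index of a generator. The
    set T can be extended as long as H T is not closed under right
    multiplication by the generators, hence until H T = G. *)
Lemma prefix_closed_transversal k : (0 < k <= #|G : H|)%N ->
  exists T : {set gT}, exists P : {set gT * 'I_d},
    [/\ [/\ #|T| = k, 1 \in T, T \subset G & {in T &, injective (rcoset H)}],
     P \subset setX T setT, #|P|.+1 = k
     & forall ti, ti \in P -> ti.1 * s ti.2 \in T].
Proof.
elim: k => // -[_ _ | k IHk lt_k].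
  exists [set 1], set0; rewrite cards1 cards0 set11 sub1G sub0set.
  by split=> // [|ti]; [split=> // x y /set1P-> /set1P-> | rewrite inE].
have [T [P [[cardT T1 sTG injT] sPT cardP PT]]] := IHk (ltnW lt_k).
have [t [i [Tt new_ti]]] : exists t, exists i, t \in T /\ t * s i \notin H * T.
  have [/forall_inP old | ] :=
    boolP [forall t in T, [forall i, t * s i \in H * T]].
    suffices: (#|G : H| <= k.+1)%N.
      by have /andP[_] := lt_k; rewrite ltnNge => /negP.
    have sGHT : G \subset H * T.
      apply: gen_sub_mulr_closed => [|_ i /mulsgP[h t Hh Tt ->]].
        by rewrite -[1]mulg1 mem_mulg.
      have /mulsgP[h' t' Hh' Tt' def_ts] := forallP (old t Tt) i.
      by rewrite -mulgA def_ts mulgA mem_mulg ?groupM.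
    rewrite -cardT -(card_in_imset injT) subset_leq_card //.
    apply/subsetP=> _ /rcosetsP[x Gx ->].
    have /mulsgP[h t Hh Tt ->] := subsetP sGHT x Gx.
    by rewrite rcosetM rcoset_id // -rcosetE imset_f.
  by case/forall_inPn=> t Tt /forallPn[i]; exists t, i.
have newT : t * s i \notin T.
  by apply: contra new_ti => Tts; rewrite -[_ * _]mul1g mem_mulg.
exists (t * s i |: T), ((t, i) |: P); split.
- split.
  + by rewrite cardsU1 newT cardT.
  + by rewrite inE T1 orbT.
  + by rewrite subUset sTG sub1set groupM ?generator_mem ?(subsetP sTG).
  move=> x y /setU1P[-> | Tx] /setU1P[-> | Ty] //.
  + rewrite !rcosetE => /rcoset_eqP/rcosetP[h Hh def_ts].
    by rewrite def_ts mem_mulg in new_ti.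
  + rewrite !rcosetE => /esym/rcoset_eqP/rcosetP[h Hh def_ts].
    by rewrite def_ts mem_mulg in new_ti.
  exact: injT.
- apply/subsetP=> ti /setU1P[-> | /(subsetP sPT)]; rewrite !inE /= ?Tt ?orbT //.
  by rewrite !andbT => ->; rewrite orbT.
- suffices new_ti' : (t, i) \notin P by rewrite cardsU1 new_ti' add1n cardP.
  by apply: contra newT => /PT.
by move=> ti /setU1P[-> | /PT Tts]; rewrite !inE /= ?eqxx ?Tts ?orbT.
Qed.

(** The generators are the t s r(t s)^-1, where t runs over a transversal, s
    over the generators of G, and r(g) is the representative of the coset of g.
    With m the index of H, the m - 1 edges of the spanning tree contribute
    trivial elements, which leaves m d - (m - 1) generators. *)
Lemma Schreier_generators :
  exists2 A : {set gT}, <<A>> = H & (#|A| + #|G : H| <= #|G : H| * d + 1)%N.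
Proof.
have [|T [P [[cardT T1 sTG injT] sPT cardP PT]]] :=
  @prefix_closed_transversal #|G : H|.
  by rewrite indexg_gt0 leqnn.
pose r g := repr (T :&: H :* g).
have rP g : g \in G -> r g \in T /\ g * (r g)^-1 \in H.
  move=> Gg; suffices /setIP[Trg Hrg] : r g \in T :&: H :* g.
    by split=> //; rewrite -mem_rcoset rcoset_sym.
  have /imsetP[t Tt eq_gt] : rcoset H g \in rcoset H @: T.
    suffices -> : rcoset H @: T = rcosets H G by rewrite imset_f.
    by apply/eqP; rewrite eqEcard imsetS //= (card_in_imset injT) cardT.
  apply: (mem_repr t); rewrite inE Tt; apply/rcoset_eqP.
  by move: eq_gt; rewrite !rcosetE.
have rT t : t \in T -> r t = t.
  move=> Tt; have Gt := subsetP sTG t Tt; have [Trt Ht] := rP t Gt.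
  apply: injT => //; rewrite !rcosetE; apply/esym/rcoset_eqP.
  by rewrite mem_rcoset.
pose gen (ti : gT * 'I_d) := ti.1 * s ti.2 * (r (ti.1 * s ti.2))^-1.
exists [set gen ti | ti in setX T setT :\: P]; last first.
  have := cardsID P (setX T setT).
  rewrite (setIidPr sPT) cardsX cardT cardsT card_ord.
  set D := _ :\: P => card_D.
  have : (#|[set gen ti | ti in D]| <= #|D|)%N by apply: leq_imset_card.
  by rewrite -card_D -{1}cardP => ?; rewrite addn1 addnS ltnS addnC leq_add2l.
set N := <<_>>; have sNH : N \subset H.
  rewrite gen_subG; apply/subsetP=> _ /imsetP[[t i] /setDP[/setXP[Tt _] _] ->].
  by case: (rP (t * s i)); rewrite // groupM ?generator_mem ?(subsetP sTG).
have sGNT : G \subset N * T.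
  apply: gen_sub_mulr_closed; first by rewrite -[1]mulg1 mem_mulg ?group1.
  move=> _ i /mulsgP[n t Nn Tt ->].
  have Gts : t * s i \in G by rewrite groupM ?generator_mem ?(subsetP sTG).
  rewrite -mulgA -[t * s i](mulgKV (r (t * s i))) mulgA.
  rewrite mem_mulg ?(proj1 (rP _ Gts)) //.
  rewrite groupM //; have [/PT /= Tts | notPti] := boolP ((t, i) \in P).
    by rewrite rT // mulgV group1.
  apply: mem_gen; apply/imsetP; exists (t, i) => //.
  by rewrite inE notPti inE Tt inE.
apply/eqP; rewrite eqEsubset sNH; apply/subsetP=> h Hh.
have /mulsgP[n t Nn Tt def_h] := subsetP sGNT h (subsetP sHG h Hh).
suffices t1 : t = 1 by rewrite def_h t1 mulg1.
apply: injT => //; rewrite !rcosetE; apply/rcoset_eqP; rewrite mulg1.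
have def_t : t = n^-1 * h by rewrite def_h mulKg.
by rewrite def_t groupM ?groupV // (subsetP sNH).
Qed.
End Generators.

(** * The exponent of the center *)

Section CenterExponent.
Import GroupScope.
Variables (gT : finGroupType) (G : {group gT}).
Local Notation Z := 'Z(G).
Local Notation m := #|G : Z|.

Lemma card_conj_aut : #|conj_aut G @* G| = m.
Proof.
rewrite card_morphim ker_conj_aut (setIidPr (normG G)) /=.
by rewrite -indexgI.
Qed.

(** The stabiliser of a central element contains the inner automorphisms. *)
Lemma leq_orbit_center z : z \in Z -> (#|orbit 'P (Aut G) z| * m <= #|Aut G|)%N.
Proof.
move=> Zz; rewrite -(card_orbit_stab 'P (Aut G) z) leq_mul2l -card_conj_aut.
apply/orP; right; apply/subset_leq_card/subsetP=> _ /morphimP[x _ Gx ->].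
have [Gz _] := setIP Zz.
rewrite inE Aut_aut; apply/astab1P; rewrite /= apermE conj_autE //.
by rewrite conjgE -(centerC Gx Zz) mulKg.
Qed.

Lemma leq_index_center : (m <= #|Aut G|)%N.
Proof. by rewrite -card_conj_aut subset_leq_card ?Aut_conj_aut. Qed.

(** Let z be central of order o = exp(Z), with orbit of length q, and let b be
    the part of o coprime to m, and a = o / b; then a phi(b) <= gcd(a, m) q.
    Bounding the gcd by m gives a phi(b) <= q m <= |Aut G|, and bounding it by a
    gives phi(b) <= q <= c. *)
Lemma leq_exponent_center c :
    (forall x, x \in G -> #|orbit 'P (Aut G) x| <= c)%N ->
  (exponent Z <= 2 * c * #|Aut G|)%N.
Proof.
move=> orbits_le.
have [z Zz oz] := exponent_witness (abelian_nil (center_abelian G)).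
set o := exponent Z in oz *; have Gz := subsetP (center_sub G) z Zz.
have o_gt0 : (0 < o)%N := exponent_gt0 _; have m_gt0 := indexg_gt0 G Z.
pose a := (o`_\pi(m))%N; pose b := (o`_\pi(m)^')%N.
have o_ab : (a * b = o)%N := partnC _ o_gt0.
pose S := orbit 'P (Aut G) z.
have co_mb : coprime m b by rewrite coprime_pi' ?part_gt0 // part_pnat.
have le_ab : (a * totient b <= gcdn a m * #|S|)%N.
  apply: (@leq_card_unit_powers _ z _ _ _ S m_gt0) => //.
    by rewrite o_ab.
    exact: part_pnat.
  move=> u u1 co_uz; have [|f AutGf fE] := @expg_aut _ G u u1.
    rewrite -(Lagrange (center_sub G)) coprimeMr -[coprime u m]coprime_modl u1.
    rewrite coprime_modl coprime1n andbT coprime_sym.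
    have pi_Z : \pi(o).-nat #|Z|.
      by rewrite pi_of_exponent; apply: pgroup_pi.
    by apply: (coprime_pi_nat o_gt0 pi_Z); rewrite coprime_sym oz.
  by rewrite -fE //; apply: mem_orbit.
have le_S : (a * totient b <= #|Aut G|)%N.
  apply: leq_trans (leq_orbit_center Zz); rewrite [leqRHS]mulnC.
  apply: leq_trans le_ab _.
  by rewrite leq_mul2r dvdn_leq ?orbT ?dvdn_gcdr.
have le_tc : (totient b <= c)%N.
  apply: leq_trans (orbits_le z Gz); rewrite -/S.
  have a_gt0 : (0 < a)%N := part_gt0 _ _.
  rewrite -(leq_pmul2l a_gt0); apply: leq_trans le_ab _.
  by rewrite leq_mul2r dvdn_leq ?orbT ?dvdn_gcdl.
rewrite -o_ab; have := leq_totient_sqr b.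
move: (totient b) (#|Aut G|) le_tc le_S => t A le_tc le_at le_bt.
apply: (@leq_trans (a * (2 * t ^ 2))); first by rewrite leq_mul2l le_bt orbT.
have -> : (a * (2 * t ^ 2) = 2 * t * (a * t))%N by rewrite expnS expn1; nia.
by rewrite leq_mul // leq_mul2l.
Qed.

(** A group without nontrivial automorphisms is abelian, and elementary abelian
    of exponent at most 2 by the exponent bound. The subgroup generated by
    x != 1 is characteristic, like every subgroup, so it is the whole group. *)
Lemma leq_card_Aut_trivial : Aut G = 1 -> (#|G| <= 2)%N.
Proof.
move=> Aut1; have fixG f x : f \in Aut G -> f x = x.
  by rewrite Aut1 => /set1P->; rewrite perm1.
have ZG : Z = G.
  apply/eqP; rewrite eqEsubset center_sub -indexg_eq1 eqn_leq indexg_gt0 andbT.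
  by rewrite (leq_trans leq_index_center) // Aut1 cards1.
have [-> | ntG] := eqsVneq G 1; first by rewrite cards1.
have abG : 2.-abelem G.
  have : (exponent Z <= 2 * 1 * #|Aut G|)%N.
    apply: leq_exponent_center => x _.
    by rewrite /orbit Aut1 set1gE imset_set1 cards1.
  rewrite ZG Aut1 cards1 => le_e2; apply: exponent2_abelem.
  by have := exponent_gt0 G; case: (exponent G) le_e2 => [|[|[]]].
have /charsimpleP[_ simG] := abelem_charsimple abG ntG.
have [x Gx ntx] := trivgPn _ ntG.
have ox : #[x] = 2 by apply: abelem_order_p abG Gx ntx.
suffices <- : <[x]> = G :> {set gT} by rewrite -orderE ox.
apply: (simG <[x]>%G); first by rewrite cycle_eq1.
apply/charP; split=> [|f injf imf]; first by rewrite cycle_subG.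
rewrite morphim_cycle //; congr <[_]>.
by rewrite -(autE injf imf) // fixG ?Aut_aut.
Qed.
End CenterExponent.

(** * The bound *)

Theorem theorem1p3 (R : realType) (c d : nat) (gT : finGroupType) (G : {group gT})
    (c_gt0 : 0 < c)
    (genG : d_generated d G)
    (orbits_le : forall x : gT, x \in G -> #|orbit 'P (Aut G) x| <= c) :
  #|G| <= c ^ (d * c ^ d * (1 + Num.truncn (d%:R * log2 (c%:R : R))%R)) + 1.
Proof.
have [c_le1 | c_gt1] := leqP c 1.
  have c1 : c = 1 by case: c c_gt0 c_le1 {orbits_le} => [|[]].
  rewrite c1 exp1n; apply: leq_card_Aut_trivial.
  apply/trivgP/subsetP=> f AutGf; rewrite inE; apply/eqP.
  apply: (eq_Aut AutGf (group1 _)) => x Gx; rewrite perm1.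
  have := orbits_le x Gx; rewrite c1 => /card_le1_eqP eq_orb.
  by apply: eq_orb; [apply: orbit_refl | apply: mem_orbit].
have [t def_G] := genG.
have [d0 | d_gt0] := posnP d.
  move: t def_G; rewrite d0 => t <-; rewrite tuple0.
  rewrite [X in <<X>>%g](_ : _ = set0); last by apply/setP=> x; rewrite !inE.
  by rewrite gen0 cards1 addn1.
have genGt : <<[set tnth t i | i : 'I_d]>>%g = G.
  rewrite -def_G; congr (<<_>>%g); apply/setP=> x; rewrite inE.
  by apply/imsetP/tnthP=> [[i _ ->] | [i ->]]; exists i.
have le_Aut := leq_card_Aut genGt orbits_le.
have [A genA le_A] := Schreier_generators genGt (center_sub G).
have cZ := center_abelian G.
apply: leq_trans (leq_addr _ _); rewrite -(Lagrange (center_sub G)) mulnC.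
have le_Z : #|'Z(G)%g| <= exponent 'Z(G)%g ^ #|A|.
  have [le_r _] := max_card_abelian cZ.
  apply: leq_trans le_r _.
  rewrite leq_pexp2l ?exponent_gt0 // -grank_abelian // -genA.
  exact: grank_min.
apply: (@leq_trans (#|G : 'Z(G)%g|%g * exponent 'Z(G)%g ^ #|A|)).
  by rewrite leq_mul2l le_Z orbT.
apply: leq_trans (leq_bound_exponent c_gt1 d_gt0 _ _ le_A) _.
- exact: leq_trans (leq_index_center G) le_Aut.
- apply: leq_trans (leq_exponent_center orbits_le) _.
  by rewrite leq_mul2l le_Aut orbT.
by rewrite leq_pexp2l // leq_mul2l leq_add2l leq_truncn_log2 // orbT.
Qed.
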